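(* Let $(A,+,\circ)$ be a brace of cardinality $p^n$ for some prime number $p$ and some natural number $n$. Let $k$ be a natural number such that $p^{k(p-1)}A=0$. Assume that $p^iA$ and $ann(p^i)$ are ideals in $A$ for every $i$ and that $(p^kA)*ann(p^{2k})\subseteq ann(p^k)$. Let $\wp^{-1}:p^kA\to A$ be a function with $p^k\wp^{-1}(x)=x$ for all $x\in p^kA$. For $a\in A$ write $[a]=a+ann(p^{2k})\in A/ann(p^{2k})$ and let $\odot$ be the (well-defined) operation on $A/ann(p^{2k})$ given by $$[x]\odot[y]=[\wp^{-1}((p^kx)*y)].$$ Let $\xi=\gamma^{p^{n-1}}$, where $\gamma$ is a primitive root modulo $p^n$, and define a binary operation $\bullet$ on $A/ann(p^{2k})$ by $$[x]\bullet[y]=\sum_{i=0}^{p-2}\xi^{p-1-i}\,[\xi^ix]\odot[y],\qquad x,y\in A.$$ Then $A/ann(p^{2k})$ with the binary operations $+$ and $\bullet$ is a pre-Lie ring.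
   Context: A (left) brace is a set $A$ with operations $+,\circ$ such that $(A,+)$ is an abelian group, $(A,\circ)$ is a group and $a\circ(b+c)+a=a\circ b+a\circ c$ for all $a,b,c$. Put $a*b=a\circ b-a-b$. An ideal is an additive subgroup $I$ with $i*a,\,a*i\in I$ for all $i\in I,a\in A$; then $A/I$ is a brace. $p^iA=\{p^ia:a\in A\}$ and $ann(p^i)=\{a\in A:p^ia=0\}$. An integer $\gamma$ is a primitive root modulo $m$ if every integer coprime to $m$ is congruent to a power of $\gamma$ modulo $m$. A pre-Lie ring $(L,+,\cdot)$ is an abelian group with a biadditive operation satisfying $(x\cdot y)\cdot z-x\cdot(y\cdot z)=(y\cdot x)\cdot z-y\cdot(x\cdot z)$ for all $x,y,z$. *)

(* Defs.v *)
From HB Require Import structures.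
From mathcomp Require Import all_boot all_order all_algebra.
From mathcomp Require Import ring_quotient.

Set Implicit Arguments.
Unset Strict Implicit.
Unset Printing Implicit Defensive.

Import Order.TTheory GRing.Theory Num.Theory.
Local Open Scope ring_scope.
Local Open Scope quotient_scope.

HB.mixin Record Zmodule_isBrace A & GRing.Zmodule A := {
  circ : A -> A -> A;
  circ_id : A;
  circ_inv : A -> A;
  circA : associative circ;
  circ_idl : left_id circ_id circ;
  circ_invl : left_inverse circ_id circ_inv circ;
  circDr : forall a b c : A, circ a (b + c) + a = circ a b + circ a c
}.

#[short(type="braceType")]
HB.structure Definition Brace := {A of Zmodule_isBrace A & GRing.Zmodule A}.

#[short(type="finBraceType")]
HB.structure Definition FinBrace := {A of Brace A & Finite A}.

Definition star (A : braceType) (a b : A) : A := circ a b - a - b.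

Record brace_ideal (A : braceType) (I : {pred A}) : Prop := BraceIdeal {
  brace_ideal_zmod : zmod_closed I;
  brace_ideal_star : forall i a : A, i \in I -> star i a \in I /\ star a i \in I
}.

Section StarTheory.

Variable A : braceType.
Implicit Types a b c : A.

Lemma circ0r a : circ a 0 = a.
Proof. by apply: (addrI (circ a 0)); rewrite -circDr addr0. Qed.

Lemma circ_id0 : circ_id = 0 :> A.
Proof. by rewrite -[LHS]circ0r circ_idl. Qed.

Lemma circE a b : circ a b = star a b + b + a.
Proof. by rewrite /star !addrNK. Qed.

Lemma starDr a b c : star a (b + c) = star a b + star a c.
Proof.
have -> : star a (b + c) = circ a b + circ a c - a - a - (b + c).
  by rewrite /star -circDr addrK.
by rewrite /star opprD -(addrA _ (- a) (- a)) (addrACA (circ a b)) [LHS]addrACA.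
Qed.

Lemma star_circl a b c :
  star (circ a b) c = star a (star b c) + star a c + star b c.
Proof.
apply: (addIr (c + circ a b)); rewrite addrA -circE -circA circE.
rewrite (circE b c).
rewrite (starDr a (star b c + c)) (starDr a (star b c) c) (circE a b).
move: (star a c) (star a b) (star b c) => u v w.
rewrite !addrA.
by rewrite [LHS](ACl (1 * 2 * 4 * 5 * 3 * 6 * 7))%AC.
Qed.

Lemma star_ideal_congr (I : {pred A}) a w c :
  brace_ideal I -> w \in I -> star (a + w) c - star a c \in I.
Proof.
move=> [[I0 IB] Istar] Iw; have IN x : x \in I -> - x \in I.
  by move=> Ix; rewrite -sub0r IB.
have ID x y : x \in I -> y \in I -> x + y \in I.
  by move=> Ix Iy; rewrite -[y]opprK IB ?IN.
pose w' := star (circ_inv a) w + w.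
have Iw' : w' \in I by rewrite ID // (Istar w _ Iw).2.
have -> : a + w = circ a w'.
  have -> : w' = circ (circ_inv a) (a + w).
    apply: (addIr (circ_inv a)); rewrite circDr circ_invl circ_id0 add0r.
    by rewrite [RHS]circE.
  rewrite circA; have -> : circ a (circ_inv a) = circ_id.
    rewrite -[LHS]circ_idl -{1}(circ_invl (circ_inv a)) -circA.
    by rewrite (circA (circ_inv a)) circ_invl circ_idl circ_invl.
  by rewrite circ_idl.
rewrite star_circl addrAC addrK.
by rewrite ID // ?(Istar _ _ (Istar w' c Iw').1).2 ?(Istar w' c Iw').1.
Qed.

End StarTheory.

Definition mulimg (A : finBraceType) (m : nat) : {set A} := [set a *+ m | a : A].

Definition ann (A : zmodType) (m : nat) : {pred A} := [pred a | a *+ m == 0].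

Arguments mulimg : clear implicits.
Arguments ann : clear implicits.

Lemma ann_zmod_closed (A : zmodType) (m : nat) : zmod_closed (ann A m).
Proof.
split=> [|a b]; first by rewrite inE mul0rn.
by rewrite !inE mulrnBl => /eqP-> /eqP->; rewrite subr0.
Qed.

HB.instance Definition _ (A : zmodType) (m : nat) :=
  GRing.isZmodClosed.Build A (ann A m) (ann_zmod_closed A m).

Notation quot_ann A m := (Quotient.quot (GRing.ZmodClosed.clone _ (ann A m) _)).

Definition primitive_root (g : int) (m : nat) : Prop :=
  forall a : int, coprimez a m -> exists j : nat, (a = g ^+ j %[mod m])%Z.

Record pre_lie_ring (L : zmodType) (mul : L -> L -> L) : Prop := PreLieRing {
  pre_lie_mulDl : left_distributive mul +%R;
  pre_lie_mulDr : right_distributive mul +%R;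
  pre_lie_assoc : forall x y z : L,
    mul (mul x y) z - mul x (mul y z) = mul (mul y x) z - mul y (mul x z)
}.

Section Operations.

Variables (A : finBraceType) (p k : nat) (wp : A -> A).

Let Q := quot_ann A (p ^ (2 * k)).

(* Computed on the chosen representatives; independence of that choice, under
   the ideal hypotheses that guarantee it, is [odot_pi] below. When
   [mulimg A (p ^ k)] is an ideal, only the values of [wp] there are used. *)
Definition odot : Q -> Q -> Q :=
  lift_op2 Q (fun x y => wp (star (x *+ p ^ k) y)).

(* [X *~ xi ^+ i] is the class of [x *~ xi ^+ i] when [X] is the class of [x],
   see [bullet_pi]. *)
Definition bullet (xi : int) (X Y : Q) : Q :=
  \sum_(i < p - 1) odot (X *~ (xi ^+ i)) Y *~ (xi ^+ (p - 1 - i)).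

Lemma bullet_pi (xi : int) (x y : A) :
  bullet xi (\pi_Q x) (\pi_Q y) =
  \sum_(i < p - 1) odot (\pi_Q (x *~ (xi ^+ i))) (\pi_Q y) *~ (xi ^+ (p - 1 - i)).
Proof. by apply: eq_bigr => i _; rewrite raddfMz. Qed.

Hypotheses (idealM : forall i, brace_ideal (mulimg A (p ^ i)))
  (idealA : forall i, brace_ideal (ann A (p ^ i)))
  (starMA : forall x y, x \in mulimg A (p ^ k) -> y \in ann A (p ^ (2 * k)) ->
     star x y \in ann A (p ^ k))
  (wpK : {in mulimg A (p ^ k), forall x, wp x *+ p ^ k = x}).

Lemma odot_pi (x y : A) :
  odot (\pi_Q x) (\pi_Q y) = \pi_Q (wp (star (x *+ p ^ k) y)).
Proof.
have eq_annP a b : reflect (\pi_Q a = \pi_Q b) (a - b \in ann A (p ^ (2 * k))).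
  by rewrite Quotient.idealrBE; apply: eqP.
unlock odot; apply/eq_annP.
set x' := repr _; set y' := repr _.
have /eq_annP annx : \pi_Q x' = \pi_Q x by rewrite reprK.
have /eq_annP anny : \pi_Q y' = \pi_Q y by rewrite reprK.
have pM z : z *+ p ^ k \in mulimg A (p ^ k) by apply: imset_f.
have starM z t : star (z *+ p ^ k) t \in mulimg A (p ^ k).
  exact: ((brace_ideal_star (idealM k)) _ _ (pM z)).1.
rewrite /ann -topredE /= mul2n -addnn expnD mulrnA mulrnBl !wpK //.
suff: star (x' *+ p ^ k) y' - star (x *+ p ^ k) y \in ann A (p ^ k) by [].
have -> : star (x' *+ p ^ k) y' =
    star (x' *+ p ^ k) y + star (x' *+ p ^ k) (y' - y).
  by rewrite -starDr addrC subrK.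
rewrite addrAC rpredD ?starMA //.
have -> : x' *+ p ^ k = x *+ p ^ k + (x' - x) *+ p ^ k.
  by rewrite -mulrnDl addrC subrK.
suff annw : (x' - x) *+ p ^ k \in ann A (p ^ k).
  exact: star_ideal_congr _ _ (idealA k) annw.
by rewrite /ann -topredE /= -mulrnA -expnD addnn -mul2n.
Qed.

End Operations.

(* Main.v *)
Require Import Defs.
From HB Require Import structures.
From mathcomp Require Import all_boot all_order all_algebra.
From mathcomp Require Import ring_quotient.
From mathcomp Require Import cyclic finfield.

Set Implicit Arguments.
Unset Strict Implicit.
Unset Printing Implicit Defensive.

Import Order.TTheory GRing.Theory Num.Theory.
Local Open Scope ring_scope.
Local Open Scope quotient_scope.

(** Write N = p - 1 and F_m = p^(km) A.  The ideal hypothesis gives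
    F_l * F_j <= F_(l+j), and F_N = 0 by assumption.  The integer xi acts on A
    with xi^N = 1, while xi^j - 1 is invertible on A for 0 < j < N.

    The star product is additive on the right but not on the left: for a in
    F_l and b in F_l', the defect (a+b)*c - a*c - b*c is a combination of brace
    words of higher degree.  To control the degree, consider the sequences i |->
    f i in A obtained by applying sums and star products to the geometric
    sequences i |-> xi^(mi) c, where c lies in F_m and has degree m
    ([homog]).  By induction on such a word f of degree m, the sequence
    f (i+1) - xi^m f i has degree at least m+1 ([homog_shift]).  The functional
    sum_(i < N) xi^(-qi) f i turns the shift into multiplication by xi^q, and
    xi^q - xi^m is invertible for q < m < N; since everything of degree N
    vanishes, a descending induction on m shows that the functional kills every
    sequence of degree m > q ([weight_proj_eq0]).

    Let g a z = sum_(i < N) xi^(-i) (xi^i a) * z for a in F_1.  The case q = 1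
    makes g additive in a ([linpartDl]).  For the pre-Lie identity, the
    relation (a + b + a*b) * c = a*(b*c) + a*c + b*c, together with the one
    where a and b are exchanged, shows that

      ((a*b)*c - a*(b*c)) - ((b*a)*c - b*(a*c))

    has degree at least 3 when a and b have degree 1 ([homog_star_asc]), so the
    case q = 2 kills it.  Replacing b by xi^r b, multiplying by xi^(-r) and
    summing over r turns this into the pre-Lie identity for g
    ([linpart_pre_lie]).

    Finally, the product of the classes of x and y has a representative x . y
    with p^k (x . y) = g (p^k x) y.  Hence p^(2k) ((x . y) . z)
    = g (g (p^k x) (p^k y)) z and p^(2k) (x . (y . z)) =
    g (p^k x) (g (p^k y) z): the identities for g are the identities for the
    quotient by ann(p^(2k)).

    When p = 2 or n = 0 the quotient is trivial; otherwise a primitive root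
    modulo p^n has order N modulo p, which yields the two properties of xi. *)

(** * The star product of a brace *)

Section BraceBasics.

Variable A : braceType.
Implicit Types a b c : A.

Lemma circ_invr a : circ a (circ_inv a) = circ_id.
Proof.
rewrite -[LHS]circ_idl -{1}(circ_invl (circ_inv a)) -circA.
by rewrite (circA (circ_inv a)) circ_invl circ_idl circ_invl.
Qed.

Lemma star0l c : star (0 : A) c = 0.
Proof. by rewrite /star -circ_id0 circ_idl circ_id0 subr0 subrr. Qed.

Lemma star0r a : star a 0 = 0.
Proof. by rewrite /star circ0r subrr subr0. Qed.

Lemma starNr a b : star a (- b) = - star a b.
Proof. by apply: (addrI (star a b)); rewrite -starDr !subrr star0r. Qed.

Lemma starBr a b c : star a (b - c) = star a b - star a c.
Proof. by rewrite starDr starNr. Qed.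

Lemma starMnr a b m : star a (b *+ m) = star a b *+ m.
Proof. by elim: m => [|m IH]; rewrite ?mulr0n ?star0r // !mulrS starDr IH. Qed.

Lemma starMzr a b (m : int) : star a (b *~ m) = star a b *~ m.
Proof. by case: m => m; rewrite ?NegzE ?mulrNz ?starNr -pmulrn starMnr pmulrn. Qed.

Lemma star_sumr I (r : seq I) (P : pred I) a (f : I -> A) :
  star a (\sum_(i <- r | P i) f i) = \sum_(i <- r | P i) star a (f i).
Proof. exact: (big_morph _ (starDr a) (star0r a)). Qed.

(** The element u with a * u + u = b, that is, the preimage of b under the
    additive automorphism u |-> a o u - a. *)
Definition lam_inv a b : A := circ (circ_inv a) (a + b).

Lemma circ_lam_inv a b : circ a (lam_inv a b) = a + b.
Proof. by rewrite /lam_inv circA circ_invr circ_idl. Qed.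

Lemma star_lam_inv a b : star a (lam_inv a b) + lam_inv a b = b.
Proof. by apply: (addIr a); rewrite -circE circ_lam_inv addrC. Qed.

Lemma lam_invE a b : lam_inv a b = b - lam_inv a (star a b).
Proof.
have circI : injective (circ a).
  by apply: (can_inj (g := circ (circ_inv a))) => x; rewrite circA circ_invl circ_idl.
apply: circI; rewrite circ_lam_inv circE starBr.
have := star_lam_inv a (star a b); set q := lam_inv _ _ => E.
by rewrite addrACA -opprD E addrAC subrr add0r addrC.
Qed.

Lemma lam_inv0 a : lam_inv a 0 = 0.
Proof. by rewrite /lam_inv addr0 circ_invl circ_id0. Qed.

(** The sum a + b is the circle product of a and [lam_inv a b]; hence the
    failure of additivity of the star product on the left. *)
Lemma star_addl a b c :
  star (a + b) c =
  star a (star (lam_inv a b) c) + star a c + star (lam_inv a b) c.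
Proof. by rewrite -circ_lam_inv star_circl. Qed.

End BraceBasics.

(** * Homogeneous sequences in a filtered brace *)

Section Graded.

(** A brace A filtered by subgroups F m, compatible with the star product, with
    F 0 = A and F N = 0.  The integers xi and zeta act on A as mutually inverse
    operators; xi has order dividing N, and xi ^+ j has no nonzero fixed point
    for 0 < j < N. *)
Variables (A : braceType) (F : nat -> {pred A}) (N : nat) (xi zeta : int).
Hypothesis F_zmod : forall m, zmod_closed (F m).
Hypothesis F_dec : forall m x, x \in F m.+1 -> x \in F m.
Hypothesis F_star : forall l j x y,
  x \in F l -> y \in F j -> star x y \in F (l + j).
Hypothesis FA : forall x, x \in F 0.
Hypothesis FN : forall x, x \in F N -> x = 0.
Hypothesis xi_zeta : forall a : A, a *~ xi *~ zeta = a.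
Hypothesis xiN : forall a : A, a *~ (xi ^+ N) = a.
Hypothesis xi_unit : forall j (a : A),
  (0 < j < N)%N -> a *~ (xi ^+ j) = a -> a = 0.

(** The sequences of degree at least m: those generated by the geometric
    sequences of ratio xi ^+ m with coefficient in F m under subtraction and
    star product, degrees being additive under the star product.  The left
    factor of a star product must have positive degree: only then is the defect
    of additivity of strictly higher degree.  Closure under pointwise equality
    is part of the definition. *)
Inductive homog : nat -> (nat -> A) -> Prop :=
| homog_ext m f g : f =1 g -> homog m f -> homog m g
| homog_gen m c : c \in F m -> homog m (fun i => c *~ (xi ^+ (m * i)))
| homogB m f g : homog m f -> homog m g -> homog m (fun i => f i - g i)
| homog_star l j f g : (0 < l)%N -> homog l f -> homog j g ->
    homog (l + j) (fun i => star (f i) (g i))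
| homog_weak m f : homog m.+1 f -> homog m f.

Lemma homog_le m m' f : (m <= m')%N -> homog m' f -> homog m f.
Proof.
move=> le; rewrite -(subnK le); elim: (m' - m)%N => [|d IH] //.
by rewrite addSn => /homog_weak.
Qed.

Lemma homog0 m : homog m (fun=> 0).
Proof.
have h : homog m (fun i => 0 *~ (xi ^+ (m * i))) by apply/homog_gen/(F_zmod m).1.
by apply: homog_ext h => i; rewrite mul0rz.
Qed.

Lemma homogN m f : homog m f -> homog m (fun i => - f i).
Proof.
by move=> hf; apply: homog_ext (homogB (homog0 m) hf) => i; rewrite sub0r.
Qed.

Lemma homogD m f g : homog m f -> homog m g -> homog m (fun i => f i + g i).
Proof.
by move=> hf /homogN hg; apply: homog_ext (homogB hf hg) => i; rewrite opprK.
Qed.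

Lemma homogMz m f (z : int) : homog m f -> homog m (fun i => f i *~ z).
Proof.
move=> hf; have hn d : homog m (fun i => f i *+ d).
  elim: d => [|d IH]; first exact: homog_ext (homog0 m).
  by apply: homog_ext (homogD hf IH) => i; rewrite mulrS.
case: z => d; first exact: homog_ext (hn d).
by apply: homog_ext (homogN (hn d.+1)) => i; rewrite NegzE mulrNz.
Qed.

Lemma homogF m f : homog m f -> forall i, f i \in F m.
Proof.
have FMz d c z : c \in F d -> c *~ z \in F d.
  move=> Fc; have [F0 FB] := F_zmod d.
  have FN' x : x \in F d -> - x \in F d by move=> Fx; rewrite -sub0r FB.
  have Fn e : c *+ e \in F d.
    elim: e => [|e IH] //.
    by rewrite mulrS -[c *+ e]opprK FB ?FN'.
  by case: z => e; [rewrite -pmulrn | rewrite NegzE mulrNz FN' // -pmulrn].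
elim=> {m f} [m f g fg _ IH i|m c Fc i|m f g _ IHf _ IHg i
              |l j f g _ _ IHf _ IHg i|m f _ IH i].
- by rewrite -fg.
- exact: FMz.
- exact: (F_zmod m).2.
- exact: F_star.
- exact: F_dec.
Qed.

Lemma homog_eq0 m f : (N <= m)%N -> homog m f -> f =1 fun=> 0.
Proof. by move=> le /(homog_le le)/homogF h i; apply: FN. Qed.

(** By descending induction on m, through
    [lam_inv a b = b - lam_inv a (star a b)]. *)
Lemma homog_lam_inv l m f g : (0 < l)%N -> homog l f -> homog m g ->
  homog m (fun i => lam_inv (f i) (g i)).
Proof.
move=> l0 hf; elim: (N - m)%N {-2}m (leqnn (N - m)) g => [|d IH] {}m.
  rewrite leqn0 subn_eq0 => le g hg; apply: homog_ext (hg) => i.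
  by rewrite (homog_eq0 le hg) lam_inv0.
move=> le g hg.
have h := homog_star l0 hf hg.
have {}h : homog m (fun i => lam_inv (f i) (star (f i) (g i))).
  have lem : (m < l + m)%N by rewrite -addn1 addnC leq_add2r.
  apply: homog_weak; apply: IH (homog_le lem h).
  by rewrite leq_subLR addSnnS -leq_subLR.
by apply: homog_ext (homogB hg h) => i; rewrite [RHS]lam_invE.
Qed.

(** The star product is additive on the left up to higher degree. *)
Lemma homog_starD l1 l2 j f g h : (0 < l1)%N -> (0 < l2)%N ->
    homog l1 f -> homog l2 g -> homog j h ->
  homog (l1 + l2 + j)
    (fun i => star (f i + g i) (h i) - star (f i) (h i) - star (g i) (h i)).
Proof.
move=> l10 l20 hf hg hh.
(* With f + g = f o g' and g = g' + f * g' = g' o d, both g' and d are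
   homogeneous, and d has degree l1 + l2. *)
pose g' i := lam_inv (f i) (g i).
have hg' : homog l2 g' by apply: homog_lam_inv hf hg.
pose d i := lam_inv (g' i) (star (f i) (g' i)).
have hd : homog (l1 + l2) d.
  exact: homog_lam_inv hg' (homog_star l10 hf hg').
have hdh : homog (l1 + l2 + j) (fun i => star (d i) (h i)).
  by apply: homog_star hd hh; rewrite addn_gt0 l10.
have h1 : homog (l1 + l2 + j) (fun i => star (g' i) (star (d i) (h i))).
  by apply: homog_le (leq_addl l2 _) (homog_star l20 hg' hdh).
have h2 : homog (l1 + l2 + j) (fun i => star (f i) (star (g' i) (h i))).
  by rewrite -addnA; apply: homog_star => //; apply: homog_star.
apply: homog_ext (homogB h2 (homogD h1 hdh)) => i.
have Eg : g i = g' i + star (f i) (g' i) by rewrite addrC star_lam_inv.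
have -> : star (g i) (h i) = star (g' i) (star (d i) (h i)) +
    star (g' i) (h i) + star (d i) (h i) by rewrite {1}Eg star_addl.
rewrite star_addl -/(g' i) (addrAC _ (star (f i) (h i))) addrK.
move: (star (f i) (star _ _)) => x.
move: (star (d i) (h i)) (star (g' i) (h i)) (star (g' i) (star _ _)) => u v w.
by rewrite [X in _ = _ - X]addrAC [X in _ = _ + X]opprD addrACA subrr addr0.
Qed.

Lemma homog_starMz l j f g (z : int) : (0 < l)%N -> homog l f -> homog j g ->
  homog (l + j).+1 (fun i => star (f i *~ z) (g i) - star (f i) (g i) *~ z).
Proof.
move=> l0 hf hg.
have ltD : ((l + j).+1 <= l + l + j)%N by rewrite -addSn leq_add2r -addn1 leq_add2l.
have hn d : homog (l + j).+1 (fun i => star (f i *+ d) (g i) - star (f i) (g i) *+ d).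
  elim: d => [|d IH].
    by apply: homog_ext (homog0 _) => i; rewrite !mulr0n star0l subrr.
  have h := homog_starD l0 l0 hf (homogMz d%:Z hf) hg.
  apply: homog_ext (homogD (homog_le ltD h) IH) => i.
  rewrite -!pmulrn !mulrS.
  move: (star (f i *+ d) (g i)) (star (f i) (g i)) (star _ _) => u v w.
  by rewrite opprD !addrA addrNK.
case: z => d; first exact: homog_ext (hn d).
have h := homog_starD l0 l0 (homogMz (- d.+1%:Z) hf) (homogMz d.+1%:Z hf) hg.
apply: homog_ext (homogN (homogD (homog_le ltD h) (hn d.+1))) => i.
rewrite NegzE !mulrNz addNr star0l sub0r -!pmulrn.
move: (star _ _) (star _ _) (star _ _) => u v w.
by rewrite addrA addrNK opprD !opprK.
Qed.

(** Shifting acts as xi ^+ m on the part of degree m, modulo higher degree. *)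
Lemma homog_shift m f :
  homog m f -> homog m.+1 (fun i => f i.+1 - f i *~ (xi ^+ m)).
Proof.
elim=> {m f} [m f g fg _ IH|m c Fc|m f g _ IHf _ IHg
              |l j f g l0 hf IHf hg IHg|m f hf IH].
- by apply: homog_ext IH => i; rewrite !fg.
- apply: homog_ext (homog0 _) => i.
  by rewrite -mulrzA -exprD mulnS addnC subrr.
- apply: homog_ext (homogB IHf IHg) => i.
  by rewrite mulrzBl !opprD !opprK addrACA.
- (* Write the shift of f as e + xi^l f with e of degree l + 1, and expand. *)
  pose e i := f i.+1 - f i *~ (xi ^+ l).
  have he : homog l.+1 e by exact: IHf.
  have hxf := homogMz (xi ^+ l) hf.
  have hf1 : homog l (fun i => f i.+1).
    by apply: homog_ext (homogD (homog_weak he) hxf) => i; rewrite addrNK.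
  have h1 := homog_star l0 hf1 IHg; rewrite addnS in h1.
  have h2 := homog_starD (ltn0Sn l) l0 he hxf hg.
  have h3 := homog_star (ltn0Sn l) he hg.
  have h4 := homog_starMz (xi ^+ l) l0 hf hg.
  have lem : ((l + j).+1 <= l.+1 + l + j)%N by rewrite addnAC leq_addr.
  have h5 := homogMz (xi ^+ j) (homogD (homogD (homog_le lem h2) h3) h4).
  apply: homog_ext (homogD h1 h5) => i.
  have -> : e i + f i *~ xi ^+ l = f i.+1 by rewrite addrNK.
  rewrite starBr starMzr addnC exprD mulrC (mulrzA (star (f i) (g i))).
  move: (star (f i.+1) (g i.+1)) (star (f i.+1) (g i)) (star (e i) (g i)).
  move: (star (f i *~ _) (g i)) (star (f i) (g i)) => u v w x y.
  by rewrite [x - y - u + y]addrAC addrNK addrA addrNK mulrzBl addrA addrNK.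
- have h : homog m.+1 (fun i => f i *~ (xi ^+ m.+1 - xi ^+ m)) by exact: homogMz.
  apply: homog_ext (homogD (homog_weak IH) h) => i.
  by rewrite mulrzBr addrA addrNK.
Qed.

Lemma mulz_xiMN (a : A) e : a *~ (xi ^+ (e * N)) = a.
Proof. by elim: e => [|e IH]; rewrite ?mulr1z // mulSn exprD mulrzA xiN. Qed.

Lemma homog_period m f : homog m f -> f N = f 0.
Proof.
elim=> {m f} [m f g fg _ IH|m c Fc|m f g _ IHf _ IHg
              |l j f g _ _ IHf _ IHg|m f _ IH] //.
- by rewrite -!fg.
- by rewrite mulz_xiMN muln0 mulr1z.
- by rewrite IHf IHg.
- by rewrite IHf IHg.
Qed.

Lemma mulz_xi_zetaX (a : A) e : a *~ (xi ^+ e) *~ (zeta ^+ e) = a.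
Proof.
rewrite -mulrzA -exprMn; elim: e => [|e IH]; first by rewrite mulr1z.
by rewrite exprS mulrzA mulrzA xi_zeta.
Qed.

Lemma mulz_zetaMN (a : A) e : a *~ (zeta ^+ (e * N)) = a.
Proof. by rewrite -{1}(mulz_xiMN a e) mulz_xi_zetaX. Qed.

Lemma mulz_zetaX (a : A) i :
  (i <= N)%N -> a *~ (zeta ^+ i) = a *~ (xi ^+ (N - i)).
Proof.
move=> le; rewrite -[RHS](mulz_xi_zetaX _ i) -[X in _ = X *~ _]mulrzA -exprD.
by rewrite subnK // xiN.
Qed.

(** For a sequence f of period N, N times the value at 0 of the component of f
    on which shifting acts as xi ^+ q; zeta ^+ (q * i) stands for
    xi ^- (q * i). *)
Definition weight_proj (q : nat) (f : nat -> A) : A :=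
  \sum_(i < N) f i *~ (zeta ^+ (q * i)).

Lemma weight_projB q f g :
  weight_proj q (fun i => f i - g i) = weight_proj q f - weight_proj q g.
Proof. by rewrite /weight_proj -sumrB; apply: eq_bigr => i _; rewrite mulrzBl. Qed.

Lemma weight_projMz q f z :
  weight_proj q (fun i => f i *~ z) = weight_proj q f *~ z.
Proof. by rewrite /weight_proj mulrz_suml; apply: eq_bigr => i _; rewrite mulrzAC. Qed.

Lemma weight_proj_shift q f : f N = f 0 ->
  weight_proj q (fun i => f i.+1) = weight_proj q f *~ (xi ^+ q).
Proof.
move=> fN; rewrite -weight_projMz.
pose h i := f i *~ (xi ^+ q) *~ (zeta ^+ (q * i)).
have Eh i : f i.+1 *~ (zeta ^+ (q * i)) = h i.+1.
  by rewrite /h mulnS exprD mulrzA mulz_xi_zetaX.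
rewrite /weight_proj (eq_bigr (fun i : 'I_N => h i.+1)) => [|i _]; last exact: Eh.
apply: (addrI (h 0)); rewrite -(big_ord_recl N h) big_ord_recr /= addrC; congr (_ + _).
rewrite /h fN muln0 mulr1z.
by rewrite mulz_zetaMN.
Qed.

(** Descending induction on m: the projection multiplies the sequence of
    [homog_shift] by xi ^+ q - xi ^+ m, which is injective on A if m < N. *)
Lemma weight_proj_eq0 q m f : (q < m)%N -> homog m f -> weight_proj q f = 0.
Proof.
elim: (N - m)%N {-2}m (leqnn (N - m)) f => [|d IH] {}m le f qm hf.
  move: le; rewrite leqn0 subn_eq0 => le.
  by rewrite /weight_proj big1 // => i _; rewrite (homog_eq0 le hf) mul0rz.
case: (leqP N m) => [leNm|ltmN].
  by apply: IH qm hf; rewrite (eqP (_ : N - m == 0)%N) // subn_eq0.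
have := IH m.+1 _ _ (ltnW qm) (homog_shift hf).
rewrite weight_projB weight_projMz (weight_proj_shift _ (homog_period hf)).
have le' : (N - m.+1 <= d)%N by rewrite leq_subLR addSnnS -leq_subLR.
move=> /(_ le')/eqP; rewrite subr_eq0 => /eqP E.
apply: (@xi_unit (m - q)%N); first by rewrite subn_gt0 qm (leq_ltn_trans (leq_subr _ _)).
rewrite -[LHS](mulz_xi_zetaX _ q) -[LHS]mulrzA -mulrzA.
rewrite mulrA -exprD subnK ?(ltnW qm) // mulrzA -E.
by rewrite mulz_xi_zetaX.
Qed.

(** * The linear part of the star product *)

Lemma F1_homog a : a \in F 1 -> homog 1 (fun i => a *~ (xi ^+ i)).
Proof. by move/homog_gen; apply: homog_ext => i; rewrite mul1n. Qed.

Lemma homog_cst z : homog 0 (fun=> z).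
Proof. by apply: homog_ext (homog_gen (FA z)) => i; rewrite mulr1z. Qed.

Lemma F1D a b : a \in F 1 -> b \in F 1 -> a + b \in F 1.
Proof.
move=> Fa Fb; have [F0 FB] := F_zmod 1.
by rewrite -[b]opprK FB // -sub0r FB.
Qed.

Lemma F1Mz a z : a \in F 1 -> a *~ z \in F 1.
Proof.
move/F1_homog/(homogMz z)/homogF/(_ 0).
by rewrite mulr1z.
Qed.

Lemma F1_sum I (r : seq I) (f : I -> A) :
  (forall i, f i \in F 1) -> \sum_(i <- r) f i \in F 1.
Proof.
move=> Ff; elim: r => [|i r IH]; first by rewrite big_nil; case: (F_zmod 1).
by rewrite big_cons F1D.
Qed.

(** Up to the factor N, the part of a |-> star a z that is linear in a. *)
Definition linpart (a z : A) : A := weight_proj 1 (fun i => star (a *~ (xi ^+ i)) z).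

Lemma linpartDr a y z : linpart a (y + z) = linpart a y + linpart a z.
Proof.
rewrite /linpart /weight_proj -big_split /=; apply: eq_bigr => i _.
by rewrite starDr mulrzDl.
Qed.

Lemma linpartMnr a z m : linpart a (z *+ m) = linpart a z *+ m.
Proof.
rewrite /linpart /weight_proj -sumrMnl; apply: eq_bigr => i _.
by rewrite starMnr pmulrn mulrzAC.
Qed.

Lemma linpart_F1 a z : a \in F 1 -> linpart a z \in F 1.
Proof.
move=> Fa; apply: F1_sum => i; apply: F1Mz.
by apply: (@F_star 1 0); rewrite ?F1Mz.
Qed.

Lemma linpartDl a b z : a \in F 1 -> b \in F 1 ->
  linpart (a + b) z = linpart a z + linpart b z.
Proof.
move=> Fa Fb; apply/eqP; rewrite -subr_eq0 opprD addrA -!weight_projB.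
have h :=
  homog_starD (ltn0Sn _) (ltn0Sn _) (F1_homog Fa) (F1_homog Fb) (homog_cst z).
apply/eqP; apply: (@weight_proj_eq0 1 2) => //; apply: homog_ext h => i.
by rewrite -mulrzDl.
Qed.

Lemma linpart0l z : linpart 0 z = 0.
Proof.
by rewrite /linpart /weight_proj big1 // => i _; rewrite mul0rz star0l mul0rz.
Qed.

Lemma linpartMnl a z m : a \in F 1 -> linpart (a *+ m) z = linpart a z *+ m.
Proof.
move=> Fa; elim: m => [|m IH]; first by rewrite linpart0l.
by rewrite !mulrS linpartDl ?IH // pmulrn F1Mz.
Qed.

Lemma linpartMzl a z (m : int) : a \in F 1 -> linpart (a *~ m) z = linpart a z *~ m.
Proof.
move=> Fa; case: m => m; first by rewrite -!pmulrn linpartMnl.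
apply: (addrI (linpart (a *+ m.+1) z)).
rewrite NegzE !mulrNz -!pmulrn -linpartDl ?subrr ?linpart0l.
- by rewrite linpartMnl // subrr.
- by rewrite pmulrn F1Mz.
- by rewrite pmulrn -mulrNz F1Mz.
Qed.

Lemma linpart_suml (r : seq nat) (f : nat -> A) z : (forall i, f i \in F 1) ->
  linpart (\sum_(i <- r) f i) z = \sum_(i <- r) linpart (f i) z.
Proof.
move=> Ff; elim: r => [|i r IH]; first by rewrite !big_nil linpart0l.
by rewrite !big_cons linpartDl ?IH ?F1_sum.
Qed.

(** The associator of the star product. *)
Definition star_asc (x y z : A) : A := star (star x y) z - star x (star y z).

(** The associator is symmetric in its first two arguments, up to higher degree:
    both f + g + f * g = f o g and f + g + g * f = g o f act through
    [star_circl], and they differ by f * g - g * f. *)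
Lemma homog_star_asc f g h : homog 1 f -> homog 1 g -> homog 0 h ->
  homog 3 (fun i => star_asc (f i) (g i) (h i) - star_asc (g i) (f i) (h i)).
Proof.
move=> hf hg hh.
have hfg : homog 2 (fun i => star (f i) (g i)) := homog_star (ltn0Sn _) hf hg.
have hgf : homog 2 (fun i => star (g i) (f i)) := homog_star (ltn0Sn _) hg hf.
have hd := homogB hfg hgf.
have hc := homogD (homogD (homog_weak hgf) hf) hg.
have h1 := homog_starD (ltn0Sn _) (ltn0Sn _) hc hd hh.
have h2 := homog_starD (ltn0Sn _) (ltn0Sn _) hd hgf hh.
apply: homog_ext (homogB (homog_weak h2) h1) => i /=.
rewrite addrNK -circE.
have -> : circ (g i) (f i) + (star (f i) (g i) - star (g i) (f i)) =
    circ (f i) (g i).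
  rewrite !circE; move: (star (f i) (g i)) (star (g i) (f i)) => u v.
  by rewrite addrC addrA addrA addrNK -addrA [f i + _]addrC addrA.
rewrite !star_circl /star_asc.
have E (V : zmodType) (u d v w y y' x : V) :
    u - d - v - (w + y + y' - (x + y' + y) - d) = u - w - (v - x).
  have -> : w + y + y' - (x + y' + y) = w - x.
    by rewrite -(addrA w) -(addrA x) [y' + y]addrC opprD addrACA subrr addr0.
  rewrite [u - d - v]addrAC opprB addrA addrNK !opprB.
  by rewrite [x - w]addrC addrACA [- v + x]addrC.
exact: E.
Qed.

Lemma sum_shift (h : nat -> A) s : (forall i, h (i + N)%N = h i) ->
  \sum_(r < N) h (s + r)%N = \sum_(r < N) h r.
Proof.
move=> hN; elim: s => [|s IH] //; rewrite -IH.
apply: (addrI (h (s + 0)%N)).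
rewrite [RHS]addrC -[in RHS](hN (s + 0)%N) addn0.
rewrite -(big_ord_recr N (fun r => h (s + r)%N)).
rewrite big_ord_recl addn0; congr (_ + _); apply: eq_bigr => i _.
by rewrite lift0 addnS.
Qed.

Lemma linpart_asc a b z : a \in F 1 -> b \in F 1 ->
  linpart (linpart a b) z - linpart a (linpart b z) =
  \sum_(s < N) \sum_(t < N)
    star_asc (a *~ (xi ^+ s)) (b *~ (xi ^+ t)) z *~ (zeta ^+ s) *~ (zeta ^+ t).
Proof.
move=> Fa Fb.
rewrite {2 3}/linpart /weight_proj.
rewrite -(big_mkord xpredT (fun i => star (a *~ xi ^+ i) b *~ zeta ^+ (1 * i))).
have Fab i : star (a *~ xi ^+ i) b \in F 1 by apply: (@F_star 1 0); rewrite ?F1Mz.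
rewrite linpart_suml => [|i]; last exact: F1Mz.
rewrite big_mkord -sumrB; apply: eq_bigr => s _.
rewrite linpartMzl // /linpart /weight_proj !mul1n -mulrzBl star_sumr -sumrB.
rewrite mulrz_suml.
apply: eq_bigr => t _; rewrite mul1n starMzr /star_asc starMzr.
by rewrite [RHS]mulrzAC !mulrzBl.
Qed.

Lemma linpart_pre_lie a b z : a \in F 1 -> b \in F 1 ->
  linpart (linpart a b) z - linpart a (linpart b z) =
  linpart (linpart b a) z - linpart b (linpart a z).
Proof.
move=> Fa Fb; apply/eqP; rewrite -subr_eq0 !linpart_asc // [X in _ - X]exchange_big.
(* The double sum of a function periodic in t is regrouped along the diagonals
   t = s + r; on each of them the weight of s is zeta ^+ (2 * s). *)
pose d s t := star_asc (a *~ (xi ^+ s)) (b *~ (xi ^+ t)) z -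
  star_asc (b *~ (xi ^+ t)) (a *~ (xi ^+ s)) z.
pose h s t := d s t *~ (zeta ^+ s) *~ (zeta ^+ t).
rewrite -sumrB.
rewrite (eq_bigr (fun s : 'I_N => \sum_(t < N) h s (s + t)%N)) => [|s _]; last first.
  rewrite sum_shift => [|t]; last first.
    have xiDN (c : A) e : c *~ xi ^+ (e + N) = c *~ xi ^+ e.
      by rewrite exprD mulrzA xiN.
    have zetaDN (c : A) e : c *~ zeta ^+ (e + N) = c *~ zeta ^+ e.
      by rewrite exprD mulrzA; have := mulz_zetaMN (c *~ zeta ^+ e) 1; rewrite mul1n.
    by rewrite /h /d zetaDN xiDN.
  rewrite -sumrB; apply: eq_bigr => t _.
  by rewrite /h /d [in RHS]mulrzBl [in RHS]mulrzBl [X in _ - X = _]mulrzAC.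
rewrite exchange_big big1 // => r _.
have hasc :=
  homog_star_asc (F1_homog Fa) (F1_homog (F1Mz (xi ^+ r) Fb)) (homog_cst z).
have E := @weight_proj_eq0 2 _ _ (leqnn 3) hasc.
apply: etrans (mul0rz A (zeta ^+ r)).
rewrite -[X in _ = X *~ _]E /weight_proj mulrz_suml.
apply: eq_bigr => s _.
have Eb : b *~ xi ^+ (s + r) = b *~ xi ^+ r *~ xi ^+ s.
  by rewrite addnC exprD mulrzA.
by rewrite /h /d Eb mulSn mul1n !exprD !mulrzA.
Qed.

End Graded.

(** * Primitive roots modulo a prime power *)

Section PrimitiveRoot.

Variables (p n : nat) (gamma : int).
Hypotheses (p_pr : prime p) (p_gt2 : (2 < p)%N) (n_gt0 : (0 < n)%N).
Hypothesis gamma_prim : primitive_root gamma (p ^ n).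

Let pcharFp := pchar_Fp p_pr.

Lemma coprimez_pexp (z : int) : (z%:~R != 0 :> 'F_p) -> coprimez z (p ^ n)%N.
Proof.
rewrite -(dvdz_pcharf pcharFp) dvdzE coprimezE absz_nat => h.
by rewrite coprime_sym coprimeXl // prime_coprime.
Qed.

Lemma eqmodz_Fp (a b : int) : (a = b %[mod (p ^ n)%N])%Z -> a%:~R = b%:~R :> 'F_p.
Proof.
move/eqP; rewrite eqz_mod_dvd => dvd; apply/eqP.
rewrite -subr_eq0 -rmorphB -(dvdz_pcharf pcharFp).
by apply: dvdz_trans dvd; rewrite dvdzE !absz_nat dvdn_exp.
Qed.

Lemma Fp_powers (y : 'F_p) : y != 0 -> exists j, y = gamma%:~R ^+ j.
Proof.
have Ey : y = (y%:Z)%:~R by rewrite -pmulrn natr_Zp.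
rewrite {1}Ey => /coprimez_pexp/gamma_prim[j /eqmodz_Fp Ej].
by exists j; rewrite Ey Ej rmorphXn.
Qed.

(** If gamma vanished modulo p, its powers would be 0 and 1 only, so - 1 = 1. *)
Lemma primitive_root_Fp_neq0 : gamma%:~R != 0 :> 'F_p.
Proof.
apply/eqP => g0; have [|j] := @Fp_powers (- 1); first by rewrite oppr_eq0 oner_neq0.
rewrite g0 expr0n; case: j => [|j] /eqP; rewrite ?oppr_eq0 ?oner_eq0 //=.
rewrite eq_sym -subr_eq0 opprK -(natrD _ 1 1) -(dvdn_pcharf pcharFp).
by move/(dvdn_leq (ltn0Sn 1)); rewrite leqNgt p_gt2.
Qed.

Lemma primitive_root_Fp_exp j : (0 < j < p - 1)%N -> gamma%:~R ^+ j != 1 :> 'F_p.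
Proof.
case/andP=> j0 jp; apply/eqP => gj.
(* Every nonzero element of 'F_p is a power of gamma, hence a root of 'X^j - 1. *)
have h : ('X^j - 1%:P : {poly 'F_p}) != 0 by rewrite -size_poly_eq0 size_XnsubC.
have := @max_poly_roots _ _ (enum (predC1 (0 : 'F_p))) h _ (enum_uniq _).
rewrite size_XnsubC // -cardE ltnS => /(_ _)/wrap[].
  apply/allP => y; rewrite mem_enum !inE => /Fp_powers[i ->].
  by rewrite rootE !hornerE -exprM mulnC exprM gj expr1n subrr.
have := cardC1 (0 : 'F_p); rewrite card_Fp // => ->.
by rewrite leqNgt -subn1 jp.
Qed.

Lemma primitive_root_exp1 :
  ((gamma ^+ (p ^ (n - 1))) ^+ (p - 1) = 1 %[mod (p ^ n)%N])%Z.
Proof.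
have cop : coprimez gamma (p ^ n)%N := coprimez_pexp primitive_root_Fp_neq0.
have pn0 : (p ^ n)%N%:Z != 0 by rewrite eqz_nat -lt0n expn_gt0 prime_gt0.
rewrite -exprM mulnC !subn1 -totient_pfactor // -modzXm.
have := modz_ge0 gamma pn0; case E : (gamma %% _)%Z => [m|//] _.
have copm : coprime m (p ^ n).
  move: cop; rewrite /coprimez -gcdz_modl E => h.
  by rewrite /coprime; apply: h.
have -> : m%:Z ^+ totient (p ^ n) = (m ^ totient (p ^ n))%N by rewrite -!natz natrX.
by rewrite !modz_nat (Euler_exp_totient copm).
Qed.

Lemma primitive_root_exp_neq1 j : (0 < j < p - 1)%N ->
  coprimez ((gamma ^+ (p ^ (n - 1))) ^+ j - 1) (p ^ n)%N.
Proof.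
move=> hj; apply: coprimez_pexp; rewrite rmorphB !rmorphXn subr_eq0 /=.
(* Modulo p, raising to the power p changes nothing. *)
have -> m : gamma%:~R ^+ (p ^ m) = gamma%:~R :> 'F_p.
  elim: m => [|m IH]; rewrite ?expr1 // expnSr exprM IH.
  by rewrite -[in X in _ ^+ X](card_Fp p_pr) expf_card.
exact: primitive_root_Fp_exp.
Qed.

End PrimitiveRoot.

(** * The pre-Lie ring *)

(** Translation by a permutes A, so it does not change the sum of all
    elements. *)
Lemma mulrn_card (A : finBraceType) (a : A) : a *+ #|{: A}| = 0.
Proof.
apply: (addrI (\sum_(x : A) x)); rewrite addr0 -sumr_const -big_split /=.
by rewrite [RHS](reindex_inj (addIr a)).
Qed.

Lemma pre_lie_ring_subsingleton (L : zmodType) (mul : L -> L -> L) :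
  (forall x y : L, x = y) -> pre_lie_ring mul.
Proof. by move=> L1; split=> x y z; apply: L1. Qed.

Theorem theorem16 (A : finBraceType) (p n k : nat) (wp : A -> A) (gamma : int) :
  prime p ->
  #|{: A}| = (p ^ n)%N ->
  (forall a : A, a *+ p ^ (k * (p - 1)) = 0) ->
  (forall i : nat, brace_ideal (mulimg A (p ^ i))) ->
  (forall i : nat, brace_ideal (ann A (p ^ i))) ->
  (forall x y : A, x \in mulimg A (p ^ k) -> y \in ann A (p ^ (2 * k)) ->
     star x y \in ann A (p ^ k)) ->
  {in mulimg A (p ^ k), forall x : A, wp x *+ p ^ k = x} ->
  primitive_root gamma (p ^ n) ->
  pre_lie_ring (@bullet A p k wp (gamma ^+ (p ^ (n - 1)))).
Proof.
move=> p_pr cardA pA0 idealM idealA starMA wpK gamma_prim.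
pose Q := quot_ann A (p ^ (2 * k)).
have eq_annP (a b : A) : reflect (\pi_Q a = \pi_Q b) ((a - b) *+ p ^ (2 * k) == 0).
  by apply: (iffP idP) => [h | /eqP]; [apply/eqP|]; rewrite -Quotient.idealrBE.
have mulrzMnAC (a : A) (u : int) m : a *~ u *+ m = a *+ m *~ u.
  by rewrite pmulrn mulrzAC -pmulrn.
have exp2k (a : A) : a *+ p ^ (2 * k) = a *+ p ^ k *+ p ^ k.
  by rewrite mul2n -addnn expnD mulrnA.
have pi_surj (X : Q) : exists x, X = \pi_Q x by exists (repr X); rewrite reprK.
have Q_trivial : (forall a : A, a *+ p ^ (2 * k) = 0) ->
    pre_lie_ring (@bullet A p k wp (gamma ^+ (p ^ (n - 1)))).
  move=> A0; apply: pre_lie_ring_subsingleton => X Y.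
  have [x ->] := pi_surj X; have [y ->] := pi_surj Y.
  by apply/eq_annP; rewrite A0.
case: (posnP n) => [n0|n_gt0].
  apply: Q_trivial => a; have := mulrn_card a.
  by rewrite cardA n0 expn0 mulr1n => ->; rewrite mul0rn.
case: (leqP p 2) => [p_le2|p_gt2].
  apply: Q_trivial => a; rewrite exp2k.
  (* Here k * (p - 1) = k, so that p ^ k already annihilates A. *)
  have -> : a *+ p ^ k = 0; last by rewrite mul0rn.
  have p2 : p = 2 by apply/eqP; rewrite eqn_leq p_le2 prime_gt1.
  by have := pA0 a; rewrite p2 muln1.
set xi := gamma ^+ _; pose N := (p - 1)%N; pose zeta : int := xi ^+ N.-1.
have N_gt0 : (0 < N)%N by rewrite subn_gt0 prime_gt1.
have pnA (a : A) : a *~ (p ^ n)%N = 0 by rewrite -pmulrn -cardA mulrn_card.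
have xiN (a : A) : a *~ xi ^+ N = a.
  apply/eqP; rewrite -subr_eq0 -[X in _ - X]mulr1z -mulrzBr.
  have /eqP := primitive_root_exp1 p_pr p_gt2 n_gt0 gamma_prim.
  rewrite eqz_mod_dvd => /dvdzP[q ->].
  by rewrite mulrC mulrzA pnA mul0rz.
have xi_zeta (a : A) : a *~ xi *~ zeta = a.
  by rewrite -mulrzA -exprS prednK.
have xi_unit j (a : A) : (0 < j < N)%N -> a *~ xi ^+ j = a -> a = 0.
  move=> hj xia; have := primitive_root_exp_neq1 p_pr n_gt0 gamma_prim hj.
  have [u [v E]] := Bezoutz (xi ^+ j - 1) (p ^ n)%N.
  move=> /eqP cop; rewrite cop in E.
  rewrite -[LHS]mulr1z -E mulrzDr mulrC (mulrC v) !mulrzA pnA mul0rz addr0.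
  by rewrite mulrzBr xia mulr1z subrr mul0rz.
(* The filtration by the ideals p ^ (k * m) A. *)
pose F m : {pred A} := [pred x | x \in mulimg A (p ^ (k * m))].
have mulM m (a : A) : a *+ m \in mulimg A m by apply: imset_f.
have F_zmod m : zmod_closed (F m) by case: (idealM (k * m)%N).
have F_dec m x : x \in F m.+1 -> x \in F m.
  by rewrite !inE => /imsetP[a _ ->]; rewrite mulnS expnD mulrnA mulM.
have F_star l j x y : x \in F l -> y \in F j -> star x y \in F (l + j)%N.
  rewrite !inE => Fx /imsetP[b _ ->].
  have /imsetP[c _ E] := ((brace_ideal_star (idealM (k * l)%N)) _ b Fx).1.
  by rewrite starMnr E -mulrnA -expnD -mulnDr mulM.
have FA x : x \in F 0 by rewrite inE muln0 -[x]mulr1n mulM.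
have FN x : x \in F N -> x = 0 by rewrite inE => /imsetP[a _ ->].
have F1 x : x *+ p ^ k \in F 1 by rewrite inE muln1 mulM.
pose g := @linpart A N xi zeta.
have gF a z : a \in F 1 -> g a z \in F 1 by apply: linpart_F1.
have gDl a b z : a \in F 1 -> b \in F 1 -> g (a + b) z = g a z + g b z.
  exact: (@linpartDl A F).
have gMl a z m : a \in F 1 -> g (a *+ m) z = g a z *+ m by apply: (@linpartMnl A F).
have gDr a y z : g a (y + z) = g a y + g a z by apply: linpartDr.
have gMr a z m : g a (z *+ m) = g a z *+ m by apply: linpartMnr.
have gPL a b z : a \in F 1 -> b \in F 1 ->
  g (g a b) z - g a (g b z) = g (g b a) z - g b (g a z).
  exact: (@linpart_pre_lie A F).
(* A representative of the product of the classes of x and y. *)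
pose B x y := \sum_(i < N) wp (star ((x *~ xi ^+ i) *+ p ^ k) y) *~ xi ^+ (N - i).
have bulletE x y : bullet wp xi (\pi_Q x) (\pi_Q y) = \pi_Q (B x y).
  rewrite bullet_pi raddf_sum; apply: eq_bigr => i _.
  by rewrite odot_pi // raddfMz.
have BE x y : B x y *+ p ^ k = g (x *+ p ^ k) y.
  rewrite /B -sumrMnl; apply: eq_bigr => i _.
  rewrite mulrzMnAC wpK; last first.
    exact: ((brace_ideal_star (idealM k)) _ _ (mulM _ _)).1.
  rewrite mul1n (mulz_zetaX xi_zeta xiN) ?(ltnW (ltn_ord i)) //.
  by rewrite mulrzMnAC.
have piE (a b : A) : a *+ p ^ k = b *+ p ^ k -> \pi_Q a = \pi_Q b.
  by move=> E; apply/eq_annP; rewrite exp2k mulrnBl E subrr mul0rn.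
split=> X Y Z; have [x ->] := pi_surj X; have [y ->] := pi_surj Y;
  have [z ->] := pi_surj Z.
- rewrite -raddfD !bulletE -raddfD; apply: piE.
  by rewrite BE !mulrnDl gDl // !BE.
- rewrite -raddfD !bulletE -raddfD; apply: piE.
  by rewrite mulrnDl !BE gDr.
- have B2l u v w : B (B u v) w *+ p ^ (2 * k) =
      g (g (u *+ p ^ k) (v *+ p ^ k)) w.
    by rewrite exp2k BE BE -gMl ?gF // -gMr.
  have B2r u v w : B u (B v w) *+ p ^ (2 * k) = g (u *+ p ^ k) (g (v *+ p ^ k) w).
    by rewrite exp2k BE -gMr BE.
  rewrite !bulletE -!raddfB; apply/eq_annP.
  rewrite mulrnBl [X in X - _]mulrnBl [X in _ - X]mulrnBl.
  by rewrite (B2l x) (B2r x) (B2l y) (B2r y) gPL // subrr.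
Qed.
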